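(* Let $\hat A$, $\hat N_1,\dots,\hat N_{m_2}$, $\hat B_1$, $\hat C$ be the reduced-order matrices computed by the Modified Bilinear IRKA algorithm (described in the context), assuming that it converged. Then these matrices satisfy the following necessary conditions for local $\mathcal L^2(\mathcal W)$-optimality: $$\begin{aligned} (a)\quad & \hat C\hat P=CP_2,\\ (b)\quad & \hat Q\hat P=Q_2P_2,\\ (c)\quad & \hat Q\Big(\sum_{j=1}^{m_2}\hat N_jk_{ij}\Big)\hat P=Q_2\Big(\sum_{j=1}^{m_2}N_jk_{ij}\Big)P_2,\quad i=1,\dots,m_2,\\ (d)\quad & \hat Q\hat B_1\mathcal W\mathcal W^T=Q_2B_1\mathcal W\mathcal W^T, \end{aligned}$$ where $\hat P\in\mathbb R^{r\times r}$, $P_2\in\mathbb R^{n\times r}$, $\hat Q\in\mathbb R^{r\times r}$, $Q_2\in\mathbb R^{r\times n}$ are the solutions to $$\begin{aligned} \hat A\hat P+\hat P\hat A^T+\sum_{i,j=1}^{m_2}\hat N_i\hat P\hat N_j^Tk_{ij}&=-\hat B_1\mathcal W(\hat B_1\mathcal W)^T,\\ AP_2+P_2\hat A^T+\sum_{i,j=1}^{m_2}N_iP_2\hat N_j^Tk_{ij}&=-B_1\mathcal W(\hat B_1\mathcal W)^T,\\ \hat A^T\hat Q+\hat Q\hat A+\sum_{i,j=1}^{m_2}\hat N_i^T\hat Q\hat N_jk_{ij}&=-\hat C^T\hat C,\\ \hat A^TQ_2+Q_2A+\sum_{i,j=1}^{m_2}\hat N_i^TQ_2N_jk_{ij}&=-\hat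 C^TC. \end{aligned}$$
   Context: Data: $A,N_i\in\mathbb R^{n\times n}$ ($i=1,\dots,m_2$), $B_1\in\mathbb R^{n\times m_1}$, $C\in\mathbb R^{p\times n}$, a covariance matrix $K=(k_{ij})\in\mathbb R^{m_2\times m_2}$ (symmetric positive semidefinite), and a regular (invertible) weight matrix $\mathcal W\in\mathbb R^{m_1\times m_1}$. Reduced matrices are real: $\hat A,\hat N_i\in\mathbb R^{r\times r}$, $\hat B_1\in\mathbb R^{r\times m_1}$, $\hat C\in\mathbb R^{p\times r}$. Stability (standing assumption): all eigenvalues of $I\otimes A+A\otimes I+\sum_{i,j=1}^{m_2}N_i\otimes N_jk_{ij}$ have negative real part, and the same holds for the reduced matrices, i.e. for $I\otimes\hat A+\hat A\otimes I+\sum_{i,j=1}^{m_2}\hat N_i\otimes\hat N_jk_{ij}$. (This is equivalent to mean square asymptotic stability of the corresponding stochastic systems with multiplicative noise.) Throughout, $\hat A$ is assumed diagonalizable (possibly over $\mathbb C$). Modified Bilinear IRKA. Input: $A,B_1,C,N_i,K,\mathcal W$. Start with an initial guess for $\hat A,\hat B_1,\hat C,\hat N_i$ and, until convergence, repeat the following iteration: 1. Compute a spectral decomposition of $\hat A$, i.e. an invertible $S$ with $D=S\hat AS^{-1}$ diagonal, and set $\tilde B_1=S\hat B_1$, $\tilde C=\hat CS^{-1}$, $\tilde N_i=S\hat N_iS^{-1}$. 2. Solve for $V,W$ (both with $n$ rows and $r$ columns): $VD+AV+\sum_{i,j=1}^{m_2}N_iV\tilde N_j^Tk_{ij}=-(B_1\mathcal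 W)(\tilde B_1\mathcal W)^T$ and $WD+A^TW+\sum_{i,j=1}^{m_2}N_i^TW\tilde N_jk_{ij}=-C^T\tilde C$ (where $^T$ is the plain transpose). 3. Replace $V$ by $\mathrm{orth}(V)$ and $W$ by $\mathrm{orth}(W)$, where $\mathrm{orth}(\cdot)$ returns an orthonormal basis of the range of a matrix (these are again $n\times r$). 4. Set the new reduced matrices ($W^TV$ being invertible) $\hat A=(W^TV)^{-1}W^TAV$, $\hat B_1=(W^TV)^{-1}W^TB_1$, $\hat C=CV$, $\hat N_i=(W^TV)^{-1}W^TN_iV$. ''Converged'' means that the iteration has reached a fixed point: the reduced matrices $(\hat A,\hat B_1,\hat C,\hat N_i)$ produced in step 4 of an iteration coincide, up to a state-space transformation $(T\hat AT^{-1},T\hat B_1,\hat CT^{-1},T\hat N_iT^{-1})$ with one invertible matrix $T\in\mathbb R^{r\times r}$, with the reduced matrices used in step 1 of that same iteration. The matrices in the claim are those produced by this iteration. *)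

(* Defs.v *)
From mathcomp Require Import all_boot all_order all_algebra.
From mathcomp Require Import reals complex mxtens.

Set Implicit Arguments.
Unset Strict Implicit.
Unset Printing Implicit Defensive.

Import Order.TTheory GRing.Theory Num.Theory.
Local Open Scope ring_scope.

(* State dimension n, m1 inputs, p outputs, m2 noise channels. The same record
   serves for the original system and for the reduced-order models. *)
Record system (F : Type) (m1 m2 p n : nat) := System {
  sysA : 'M[F]_n;
  sysB : 'M[F]_(n, m1);
  sysC : 'M[F]_(p, n);
  sysN : 'I_m2 -> 'M[F]_n }.

(* Componentwise equality, so that no extensionality is needed for sysN. *)
Definition sys_eq (F : Type) (m1 m2 p n : nat) (s t : system F m1 m2 p n) : Prop :=
  [/\ sysA s = sysA t, sysB s = sysB t, sysC s = sysC t
    & forall i, sysN s i = sysN t i].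

Definition transform (F : comUnitRingType) (m1 m2 p n : nat) (T : 'M[F]_n)
    (s : system F m1 m2 p n) : system F m1 m2 p n :=
  System (T *m sysA s *m invmx T) (T *m sysB s) (sysC s *m invmx T)
         (fun i => T *m sysN s i *m invmx T).

(* Petrov-Galerkin projection; meaningful when W^T *m V is invertible. *)
Definition project (F : comUnitRingType) (m1 m2 p n r : nat)
    (V W : 'M[F]_(n, r)) (s : system F m1 m2 p n) : system F m1 m2 p r :=
  let E := invmx (W^T *m V) in
  System (E *m W^T *m sysA s *m V) (E *m W^T *m sysB s) (sysC s *m V)
         (fun i => E *m W^T *m sysN s i *m V).

Definition cmx (R : realType) (m n : nat) (M : 'M[R]_(m, n)) : 'M[R[i]]_(m, n) :=
  map_mx (real_complex R) M.

Definition csys (R : realType) (m1 m2 p n : nat) (s : system R m1 m2 p n) :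
    system R[i] m1 m2 p n :=
  System (cmx (sysA s)) (cmx (sysB s)) (cmx (sysC s)) (fun i => cmx (sysN s i)).

Definition covariance_mx (R : realType) (m : nat) (K : 'M[R]_m) : Prop :=
  K^T = K /\ forall x : 'cV[R]_m, 0 <= (x^T *m K *m x) 0 0.

Definition lyapunov_kron (R : realType) (m1 m2 p n : nat) (K : 'M[R]_m2)
    (s : system R m1 m2 p n) : 'M[R]_(n * n) :=
  1%:M *t sysA s + sysA s *t 1%:M
    + \sum_(i < m2) \sum_(j < m2) K i j *: (sysN s i *t sysN s j).

Definition ms_stable (R : realType) (m1 m2 p n : nat) (K : 'M[R]_m2)
    (s : system R m1 m2 p n) : Prop :=
  forall z : R[i], eigenvalue (cmx (lyapunov_kron K s)) z -> complex.Re z < 0.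

(* The columns of X form an orthonormal basis (for the Hermitian inner product)
   of the range of V; unitarymx and ==%MS are about rows, hence the transposes. *)
Definition is_orth (C : numClosedFieldType) (n r : nat) (V X : 'M[C]_(n, r)) : Prop :=
  X^T \is unitarymx /\ (X^T == V^T)%MS.

(* One pass of the loop, as a relation, since the spectral decomposition and the
   orthonormal bases are not unique. The eigenvalues of the current reduced
   matrix may be complex, so S, V, W, Vo, Wo are complex, with plain transposes
   throughout. The new model is real: the real matrices of rom' are those
   obtained by projection. *)
Definition birka_step (R : realType) (m1 m2 p n r : nat)
    (K : 'M[R]_m2) (Wt : 'M[R]_m1) (s : system R m1 m2 p n)
    (rom rom' : system R m1 m2 p r) : Prop :=
  exists (S : 'M[R[i]]_r) (V W Vo Wo : 'M[R[i]]_(n, r)),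
    let sc := csys s in
    let t := transform S (csys rom) in
    let D := sysA t in
    (S \in unitmx /\ is_diag_mx D) /\
    (V *m D + sysA sc *m V
       + \sum_(i < m2) \sum_(j < m2)
           (K i j)%:C%C *: (sysN sc i *m V *m (sysN t j)^T)
     = - ((sysB sc *m cmx Wt) *m (sysB t *m cmx Wt)^T)) /\
    (W *m D + (sysA sc)^T *m W
       + \sum_(i < m2) \sum_(j < m2)
           (K i j)%:C%C *: ((sysN sc i)^T *m W *m sysN t j)
     = - ((sysC sc)^T *m sysC t)) /\
    (is_orth V Vo /\ is_orth W Wo) /\
    (Wo^T *m Vo \in unitmx /\ sys_eq (csys rom') (project Vo Wo sc)).

Definition birka_converged (R : realType) (m1 m2 p r : nat)
    (rom rom' : system R m1 m2 p r) : Prop :=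
  exists2 T : 'M[R]_r, T \in unitmx & sys_eq rom' (transform T rom).

(* rom is returned by a run x 0, x 1, ..., x k.+1 whose last pass reached a fixed
   point; x 0 is the (arbitrary) initial guess. *)
Definition birka_output (R : realType) (m1 m2 p n r : nat)
    (K : 'M[R]_m2) (Wt : 'M[R]_m1) (s : system R m1 m2 p n)
    (rom : system R m1 m2 p r) : Prop :=
  exists (k : nat) (x : nat -> system R m1 m2 p r),
    [/\ forall l : nat, (l <= k)%N -> birka_step K Wt s (x l) (x l.+1),
        birka_converged (x k) (x k.+1)
      & rom = x k.+1].

(* Main.v *)
Require Import Defs.
From mathcomp Require Import all_boot all_order all_algebra.
From mathcomp Require Import reals complex mxtens.
From mathcomp Require Import classical_sets ring lra polyrcf.

Import Order.TTheory GRing.Theory Num.Theory.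
Local Open Scope ring_scope.

Set Implicit Arguments.
Unset Strict Implicit.

(** Write L_(A,B)(X) = A X + X B^T + sum_ij k_ij N_i X M_j^T for the generalised
    Sylvester operator attached to two systems with state matrices A, B and
    noise matrices N_i, M_i; in the code this is [gsylv K A N B M].  The four
    Gramian equations are equations for such operators, with source terms
    built from the inputs and outputs.

    The interpolation conditions are linear algebra once these operators are
    injective.  At a fixed point the spectral coordinates used inside the step
    are coordinates of the final reduced model, up to a change of basis S
    (the state-space transformation is absorbed in S).  Then V S^{-T} and W S
    solve the equations that define P2 and Q2^T, so by uniqueness V = P2 S^T
    and W S = Q2^T ([spectral_V], [spectral_W]): the orthonormal bases Vo, Wo
    have their columns in the ranges of P2 and of Q2^T.  Let T be the left
    inverse (Wo^T Vo)^{-1} Wo^T of Vo.  Applying T to the equation of P2 turns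
    it into the equation of Ph, and multiplying the equation of Q2 by Vo turns
    it into the equation of Qh, because the reduced matrices are T A Vo and so
    on.  Hence Ph = T P2 and Qh = Q2 Vo, while P2 = Vo T P2 and Q2 = Q2 Vo T,
    and all four conditions can be read off ([projection_interpolates]).

    What remains is injectivity of the mixed operator L_(A,B), where the
    stability hypotheses only speak of L_(A,A) and L_(B,B) ([gsylv_inj]).
    Stability yields positive semidefinite P, Q with L_(A,A)(P) and
    L_(B,B)(Q) negative multiples of the identity ([stable_lyapunov]).
    If L_(A,B)(X) = 0, the symmetric block matrix Z with off-diagonal blocks X
    and X^T is in the kernel of the operator of the direct sum system, and all
    the matrices diag(P, Q) - c Z have the same negative definite image.  They
    stay positive semidefinite for every c, which forces Z = 0.

    Both existence of P and positivity of P - c Z rest on one observation: if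
    X is positive semidefinite and X v = 0 then v^T L_(A,A)(X) v >= 0
    ([gsylv_ker_ge0]).  So along a path of symmetric matrices whose images are
    negative definite no positive semidefinite matrix can be singular, and
    positivity cannot be lost along the path ([psd_path]).  The path for P
    solves ((1-t) I - t L)(X_t) = (positive constant) I and starts at the
    identity; its entries are made polynomial in t with the adjugate. *)

(** * Bilinear forms and positive semidefinite matrices *)

Definition bil {R : comNzRingType} {n m : nat} (M : 'M[R]_(n, m))
    (u : 'cV[R]_n) (v : 'cV[R]_m) : R :=
  (u^T *m M *m v) 0 0.

Definition psd {R : realType} {n : nat} (M : 'M[R]_n) : Prop :=
  M^T = M /\ forall v : 'cV[R]_n, 0 <= bil M v v.

Section Bilinear.
Variable R : comNzRingType.

Lemma bilE n m (M : 'M[R]_(n, m)) u v :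
  bil M u v = \sum_i \sum_j u i 0 * M i j * v j 0.
Proof.
rewrite /bil mxE exchange_big; apply: eq_bigr => j _ /=.
by rewrite mxE mulr_suml; apply: eq_bigr => i _; rewrite mxE.
Qed.

Lemma bilDl n m (M : 'M[R]_(n, m)) u u' v :
  bil M (u + u') v = bil M u v + bil M u' v.
Proof. by rewrite /bil linearD /= !mulmxDl mxE. Qed.

Lemma bilDr n m (M : 'M[R]_(n, m)) u v v' :
  bil M u (v + v') = bil M u v + bil M u v'.
Proof. by rewrite /bil mulmxDr mxE. Qed.

Lemma bilZl n m (M : 'M[R]_(n, m)) a u v : bil M (a *: u) v = a * bil M u v.
Proof. by rewrite /bil linearZ /= -!scalemxAl mxE. Qed.

Lemma bilZr n m (M : 'M[R]_(n, m)) a u v : bil M u (a *: v) = a * bil M u v.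
Proof. by rewrite /bil -!scalemxAr mxE. Qed.

Lemma bilDm n m (M M' : 'M[R]_(n, m)) u v :
  bil (M + M') u v = bil M u v + bil M' u v.
Proof. by rewrite /bil mulmxDr mulmxDl mxE. Qed.

Lemma bilZm n m a (M : 'M[R]_(n, m)) u v : bil (a *: M) u v = a * bil M u v.
Proof. by rewrite /bil -scalemxAr -scalemxAl mxE. Qed.

Lemma bil_tr n m (M : 'M[R]_(n, m)) u v : bil M^T v u = bil M u v.
Proof.
by rewrite /bil -[in RHS](trmxK (_ *m v)) [in RHS]mxE !trmx_mul trmxK mulmxA.
Qed.

Lemma bil_summ n m (I : Type) (s : seq I) (F : I -> 'M[R]_(n, m)) u v :
  bil (\sum_(i <- s) F i) u v = \sum_(i <- s) bil (F i) u v.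
Proof. by rewrite /bil mulmx_sumr mulmx_suml summxE. Qed.

Lemma bil_mul n m n' m' (M : 'M[R]_(n, m)) (L : 'M[R]_(n', n))
    (Q : 'M[R]_(m, m')) u v :
  bil (L *m M *m Q) u v = bil M (L^T *m u) (Q *m v).
Proof. by rewrite /bil trmx_mul trmxK !mulmxA. Qed.

Lemma bil_suml n m (M : 'M[R]_(n, m)) (I : Type) (s : seq I) (U : I -> 'cV[R]_n) v :
  bil M (\sum_(i <- s) U i) v = \sum_(i <- s) bil M (U i) v.
Proof. by rewrite /bil linear_sum /= mulmx_suml mulmx_suml summxE. Qed.

Lemma bil_sumr n m (M : 'M[R]_(n, m)) (I : Type) (s : seq I) (U : I -> 'cV[R]_m) v :
  bil M v (\sum_(i <- s) U i) = \sum_(i <- s) bil M v (U i).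
Proof. by rewrite /bil mulmx_sumr summxE. Qed.

Lemma bil_outer n m (a : 'cV[R]_n) (b : 'cV[R]_m) u v :
  bil (a *m b^T) u v = (u^T *m a) 0 0 * (b^T *m v) 0 0.
Proof.
by rewrite /bil mulmxA -mulmxA {1}[u^T *m a]mx11_scalar mul_scalar_mx mxE.
Qed.
End Bilinear.

Section PSD.
Variable R : realType.

Lemma psd_cauchy_schwarz n (M : 'M[R]_n) u v :
  psd M -> (bil M u v) ^+ 2 <= bil M u u * bil M v v.
Proof.
move=> [sM pM].
have H t : 0 <= bil M u u + 2 * t * bil M u v + t ^+ 2 * bil M v v.
  have := pM (u + t *: v).
  by rewrite !bilDl !bilDr !bilZl !bilZr -[bil M v u]bil_tr sM; lra.
move: (pM u) (pM v) H; move: (bil M u u) (bil M u v) (bil M v v) => a b c a0 c0 H.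
have [c1|c1] := ltrP 0 c.
  (* the minimiser of the quadratic polynomial *)
  have := H (- b / c).
  have -> : a + 2 * (- b / c) * b + (- b / c) ^+ 2 * c = (a * c - b ^+ 2) / c.
    by field; rewrite gt_eqF.
  by rewrite pmulr_lge0 ?invr_gt0 // subr_ge0.
have -> : c = 0 by lra.
have [->|b0] := eqVneq b 0; first by lra.
(* the polynomial is affine in t with slope 2 b; this t makes it equal to -1 *)
have := H (- (a + 1) / (2 * b)).
have -> : c = 0 by lra.
have -> : a + 2 * (- (a + 1) / (2 * b)) * b
          + (- (a + 1) / (2 * b)) ^+ 2 * 0 = -1 by field.
lra.
Qed.

(** Symmetric Gaussian elimination: if K i i > 0, subtracting the rank one
    matrix (K e_i)(K e_i)^T / K i i keeps K positive semidefinite by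
    Cauchy-Schwarz and kills its i-th diagonal entry, without creating new
    nonzero diagonal entries. *)
Lemma psd_sum_rank1 n (K : 'M[R]_n) :
  psd K -> exists s : seq 'cV[R]_n, K = \sum_(l <- s) l *m l^T.
Proof.
have [k] := ubnP #|[pred i | K i i != 0]|; elim: k K => // k IH K /ltnSE leK pK.
pose e i : 'cV[R]_n := delta_mx i 0.
have eE (M : 'M[R]_n) i j : bil M (e i) (e j) = M i j.
  by rewrite /bil trmx_delta -rowE -colE !mxE.
have CS u v := psd_cauchy_schwarz u v pK; case: pK => sK pK.
(* a zero diagonal forces K = 0, again by Cauchy-Schwarz *)
have [i Ki0|K0] := pickP (fun i => K i i != 0); last first.
  exists [::]; rewrite big_nil; apply/matrixP => i j; apply/eqP.
  rewrite mxE -sqrf_eq0 eq_le sqr_ge0 andbT -(eE K i j) (le_trans (CS _ _)) //.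
  by rewrite !eE (eqP (negbFE (K0 i))) mul0r.
have Ki : 0 < K i i by rewrite lt_neqAle eq_sym Ki0 -eE pK.
pose l := K *m e i; pose K' := K - (K i i)^-1 *: (l *m l^T).
have lE v : bil (l *m l^T) v v = bil K (e i) v ^+ 2.
  rewrite bil_outer expr2 -{1}[bil K (e i) v]bil_tr sK.
  by rewrite /bil mulmxA trmx_mul sK.
have K'E v : bil K' v v = bil K v v - (K i i)^-1 * bil K (e i) v ^+ 2.
  by rewrite bilDm -scaleNr bilZm lE mulNr.
have pK' : psd K'.
  split; first by rewrite linearB linearZ /= trmx_mul trmxK sK.
  move=> v; rewrite K'E subr_ge0 mulrC ler_pdivrMr // mulrC -[X in _ <= X * _]eE.
  exact: CS.
have dK' j : K' j j <= K j j.
  by rewrite -!eE K'E gerBl mulr_ge0 ?sqr_ge0 // invr_ge0 ltW.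
have [|s sE] := IH K' _ pK'; last first.
  exists ((Num.sqrt (K i i)^-1 *: l) :: s); rewrite big_cons -sE.
  rewrite linearZ /= -scalemxAl -scalemxAr scalerA -expr2.
  by rewrite sqr_sqrtr ?invr_ge0 ?ltW // addrC subrK.
apply: (leq_trans _ leK); apply: proper_card; apply/properP; split.
  apply/fintype.subsetP => j; rewrite !inE; apply: contra => /eqP Kj0.
  by rewrite eq_le -[X in _ <= X]Kj0 dK' -eE pK'.2.
by exists i; rewrite !inE // negbK -eE K'E !eE expr2 mulrA mulVf // mul1r subrr.
Qed.

(** The trace form of Schur's product theorem; splitting K into rank one
    terms leaves a sum of values of the quadratic form of X. *)
Lemma psd_sum_ge0 m (K : 'M[R]_m) n (X : 'M[R]_n) (w : 'I_m -> 'cV[R]_n) :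
  psd K -> psd X -> 0 <= \sum_i \sum_j K i j * bil X (w i) (w j).
Proof.
move=> /psd_sum_rank1 [s KE] [_ pX].
have -> : \sum_i \sum_j K i j * bil X (w i) (w j) =
    \sum_(l <- s) bil X (\sum_i l i 0 *: w i) (\sum_i l i 0 *: w i).
  transitivity (\sum_i \sum_j \sum_(l <- s) l i 0 * l j 0 * bil X (w i) (w j)).
    apply: eq_bigr => i _; apply: eq_bigr => j _.
    rewrite KE summxE mulr_suml; apply: eq_bigr => l _.
    by rewrite mxE big_ord_recl big_ord0 addr0 !mxE.
  under eq_bigr do rewrite exchange_big /=.
  rewrite exchange_big; apply: eq_bigr => l _.
  rewrite bil_suml; apply: eq_bigr => i _.
  rewrite bil_sumr; apply: eq_bigr => j _.
  by rewrite bilZl bilZr mulrA.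
by apply: sumr_ge0 => l _; apply: pX.
Qed.

Lemma bil1_ge n (v : 'cV[R]_n) i j : `|v i 0 * v j 0| <= bil 1%:M v v.
Proof.
have E : bil 1%:M v v = \sum_k v k 0 ^+ 2.
  rewrite /bil mulmx1 mxE; apply: eq_bigr => k _.
  by rewrite mxE expr2.
have le k : `|v k 0| ^+ 2 <= bil 1%:M v v.
  rewrite E (bigD1 k) //= real_normK ?num_real // lerDl.
  by apply: sumr_ge0 => ? _; exact: sqr_ge0.
rewrite normrM; have := le i; have := le j.
by have := sqr_ge0 (`|v i 0| - `|v j 0|); nra.
Qed.

Lemma bil1_ge0 n (v : 'cV[R]_n) : 0 <= bil 1%:M v v.
Proof.
rewrite bilE; apply: sumr_ge0 => i _; apply: sumr_ge0 => j _; rewrite mxE.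
by case: eqP => [->|_]; rewrite ?mulr1 ?mulr0 ?mul0r // -expr2 sqr_ge0.
Qed.

Lemma bil1_eq0 n (v : 'cV[R]_n) : bil 1%:M v v = 0 -> v = 0.
Proof.
move=> v0; apply/matrixP => i j; rewrite [j]ord1 [RHS]mxE; apply/eqP.
by have := bil1_ge v i i; rewrite v0 normr_le0 -expr2 sqrf_eq0.
Qed.

Lemma bil_norm_le n (M : 'M[R]_n) v :
  `|bil M v v| <= (\sum_i \sum_j `|M i j|) * bil 1%:M v v.
Proof.
rewrite bilE mulr_suml; apply: (le_trans (ler_norm_sum _ _ _)).
apply: ler_sum => i _.
rewrite mulr_suml; apply: (le_trans (ler_norm_sum _ _ _)).
apply: ler_sum => j _.
by rewrite mulrAC mulrC normrM ler_wpM2l ?normr_ge0 // bil1_ge.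
Qed.

Lemma psd_ker n (M : 'M[R]_n) v : psd M -> bil M v v = 0 -> M *m v = 0.
Proof.
move=> pM v0; apply: bil1_eq0.
have := psd_cauchy_schwarz (M *m v) v pM; rewrite v0 mulr0 => H.
have /eqP : bil M (M *m v) v == 0 by rewrite -sqrf_eq0 eq_le sqr_ge0 H.
by rewrite /bil mulmx1 mulmxA.
Qed.

(** Cauchy-Schwarz for the vectors G v and v, where G = M^-1, reads
    |v|^4 <= (v^T G v) (v^T M v), and v^T G v is bounded by a multiple of
    |v|^2; so coercivity needs no compactness argument. *)
Lemma psd_coercive n (M : 'M[R]_n) :
  psd M -> (forall v : 'cV[R]_n, M *m v = 0 -> v = 0) ->
  exists2 c, 0 < c & forall v, bil 1%:M v v <= c * bil M v v.
Proof.
move=> pM kM.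
have uM : M \in unitmx.
  rewrite -unitmx_tr -row_free_unit -kermx_eq0; apply/eqP/row_matrixP => i.
  rewrite row0; apply: trmx_inj; rewrite trmx0; apply: kM.
  by apply: trmx_inj; rewrite trmx_mul trmxK -row_mul mulmx_ker row0 trmx0.
pose G := invmx M; pose c := \sum_i \sum_j `|G i j|.
have c0 : 0 <= c by do 2![apply: sumr_ge0 => ? _]; exact: normr_ge0.
exists (c + 1); first by lra.
move=> v; have M0 := pM.2 v.
have := bil1_ge0 v; rewrite le_eqVlt => /predU1P [<-|v0]; first by nra.
have := psd_cauchy_schwarz (G *m v) v pM.
have -> : bil M (G *m v) v = bil 1%:M v v.
  by rewrite /bil trmx_mul trmx_inv pM.1 -!mulmxA mulKmx // mul1mx.
have -> : bil M (G *m v) (G *m v) = bil G v v.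
  by rewrite -[LHS]bil_tr pM.1 /bil trmx_mul trmx_inv pM.1 -!mulmxA mulKVmx.
have := bil_norm_le G v; rewrite -/c ler_norml => /andP[_ Gc] H.
have : bil 1%:M v v ^+ 2 <= c * bil 1%:M v v * bil M v v.
  by apply: (le_trans H); rewrite ler_wpM2r.
rewrite expr2 mulrAC ler_pM2r //; lra.
Qed.
End PSD.

(** * Positivity along polynomial paths of matrices *)

Section Path.
Variable R : realType.
Implicit Types t : R.

Definition mxeval n (F : 'M[{poly R}]_n) t : 'M[R]_n :=
  map_mx (horner_eval t) F.

Lemma bil_mxeval n (F : 'M[{poly R}]_n) v :
  exists q : {poly R}, forall t, bil (mxeval F t) v v = q.[t].
Proof.
exists (bil F (map_mx polyC v) (map_mx polyC v)) => t.
rewrite !bilE horner_sum; apply: eq_bigr => i _.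
rewrite horner_sum; apply: eq_bigr => j _.
by rewrite !mxE !hornerE.
Qed.

Lemma bil_mxeval_lipschitz n (F : 'M[{poly R}]_n) : exists2 k, 0 < k &
  forall s t v, 0 <= s <= 1 -> 0 <= t <= 1 ->
  `|bil (mxeval F t) v v - bil (mxeval F s) v v| <= k * `|t - s| * bil 1%:M v v.
Proof.
pose k i j := s2val (poly_lipshitz (F i j) 0 1).
have k0 i j : 0 <= k i j.
  by apply: (le_trans ler01); rewrite /k; case: poly_lipshitz.
have kP i j s t : 0 <= s <= 1 -> 0 <= t <= 1 ->
    `|mxeval F t i j - mxeval F s i j| <= k i j * `|t - s|.
  move=> s01 t01; rewrite !mxE /k; case: poly_lipshitz => x _ /=.
  by apply; rewrite in_itv.
exists (\sum_i \sum_j k i j + 1).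
  by apply: ltr_wpDl => //; do 2![apply: sumr_ge0 => ? _].
move=> s t v s01 t01.
have -> : bil (mxeval F t) v v - bil (mxeval F s) v v =
          bil (mxeval F t - mxeval F s) v v.
  by rewrite bilDm -scaleN1r bilZm mulN1r.
apply: (le_trans (bil_norm_le _ _)); rewrite ler_wpM2r ?bil1_ge0 //.
rewrite mulrDl ler_wpDr ?mulr_ge0 // !mulr_suml; apply: ler_sum => i _.
rewrite mulr_suml; apply: ler_sum => j _.
by have := kP i j s t s01 t01; rewrite !mxE.
Qed.

(** The set of times up to which the path is positive semidefinite is closed
    (each quadratic form is a polynomial in t) and, since a nonsingular
    positive semidefinite matrix is coercive, open in [0, 1].  Hence a path
    that never meets a singular positive semidefinite matrix cannot leave the
    cone. *)
Lemma psd_path n (F : 'M[{poly R}]_n) :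
  (forall t, 0 <= t <= 1 -> (mxeval F t)^T = mxeval F t) ->
  psd (mxeval F 0) ->
  (forall t (v : 'cV[R]_n), 0 <= t <= 1 -> psd (mxeval F t) ->
     mxeval F t *m v = 0 -> v = 0) ->
  psd (mxeval F 1).
Proof.
move=> sF F0 kF.
pose E : set R :=
  fun t => 0 <= t <= 1 /\ forall s, 0 <= s <= t -> psd (mxeval F s).
have E0 : E 0 by split=> [|s /le_anti <-] //; rewrite lexx ler01.
have supE : has_sup E by split; [exists 0|exists 1 => t [/andP[]]].
pose T := sup E.
have T0 : 0 <= T by apply: sup_upper_bound.
have T1 : T <= 1 by apply: ge_sup; [exists 0|move=> t [/andP[]]].
have T01 : 0 <= T <= 1 by rewrite T0.
have below s : 0 <= s -> s < T -> psd (mxeval F s).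
  move=> s0 sT; have Ts : 0 < T - s by rewrite subr_gt0.
  have [t [_ Et] st] := sup_adherent Ts supE.
  by apply: Et; rewrite s0 ltW //; move: st; rewrite -/T; lra.
have [k k0 kP] := bil_mxeval_lipschitz F.
(* closedness: a negative value at T would persist slightly before T *)
have pT : psd (mxeval F T).
  split=> [|v]; first exact: sF.
  rewrite leNgt; apply/negP => q0.
  have [T_eq0|Tn0] := eqVneq T 0; first by have := F0.2 v; rewrite -T_eq0; lra.
  have [q qE] := bil_mxeval F v; rewrite qE in q0.
  have [|d d0 dP] := @poly_cont R T q (- q.[T]); first by lra.
  pose s := Num.max (T - d / 2) 0.
  have sT : s < T by rewrite gt_max; apply/andP; split; lra.
  have s0 : 0 <= s by rewrite le_max lexx orbT.
  have sd : T - d / 2 <= s by rewrite le_max lexx.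
  have := (below s s0 sT).2 v; rewrite qE.
  have /dP : `|s - T| < d by rewrite ltr_norml; lra.
  by rewrite ltr_norml; lra.
(* openness: the form at T is at least |v|^2 / c and k is a Lipschitz constant
   relative to |v|^2, so positivity persists up to distance 1/(c k) *)
have [c c0 cP] := psd_coercive pT (fun v => kF T v T01 pT).
pose d := (c * k)^-1.
have ck0 : 0 < c * k by rewrite mulr_gt0.
have d0 : 0 < d by rewrite invr_gt0.
have near s : 0 <= s <= 1 -> `|s - T| <= d -> psd (mxeval F s).
  move=> s01 sd; split=> [|v]; first exact: sF.
  have := kP T s v T01 s01; rewrite ler_norml => /andP[H _].
  rewrite -(pmulr_rge0 _ c0); have := cP v.
  have : c * (k * `|s - T| * bil 1%:M v v) <= bil 1%:M v v.
    rewrite !mulrA -[X in _ <= X]mul1r ler_wpM2r ?bil1_ge0 //.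
    by rewrite -(mulfV (lt0r_neq0 ck0)) ler_pM2l.
  have : 0 <= c * (bil (mxeval F s) v v - bil (mxeval F T) v v
                   + k * `|s - T| * bil 1%:M v v).
    by rewrite pmulr_rge0 //; lra.
  rewrite !mulrDr mulrN; lra.
have [->|Tn1] := eqVneq 1 T; first by [].
pose s := Num.min (T + d) 1.
have sT : T < s by rewrite lt_min ltrDl d0 lt_neqAle T1 eq_sym Tn1.
have s1 : s <= 1 by rewrite ge_min lexx orbT.
have sd : s <= T + d by rewrite ge_min lexx.
suff /(sup_upper_bound supE) : E s by rewrite leNgt sT.
split; first by rewrite s1 andbT; lra.
move=> u /andP[u0 us]; have [uT|Tu] := ltP u T; first exact: below.
by apply: near; [apply/andP; split; lra|rewrite ler_norml; lra].
Qed.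
End Path.

(** * Generalised Sylvester operators *)

Definition gsylv {F : comNzRingType} {k n m : nat} (K : 'M[F]_k)
    (A : 'M[F]_n) (N : 'I_k -> 'M[F]_n) (B : 'M[F]_m) (M : 'I_k -> 'M[F]_m)
    (X : 'M[F]_(n, m)) : 'M[F]_(n, m) :=
  A *m X + X *m B^T + \sum_(i < k) \sum_(j < k) K i j *: (N i *m X *m (M j)^T).

Definition trN {F : Type} {k n : nat} (N : 'I_k -> 'M[F]_n) (i : 'I_k) : 'M[F]_n :=
  (N i)^T.

Definition gsylv_injective {F : comNzRingType} {k n m : nat} (K : 'M[F]_k)
    (A : 'M[F]_n) (N : 'I_k -> 'M[F]_n) (B : 'M[F]_m) (M : 'I_k -> 'M[F]_m) :
    Prop :=
  forall X : 'M[F]_(n, m), gsylv K A N B M X = 0 -> X = 0.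

Section GSylv.
Variables (F : comNzRingType) (k n m : nat) (K : 'M[F]_k).
Variables (A : 'M[F]_n) (N : 'I_k -> 'M[F]_n) (B : 'M[F]_m) (M : 'I_k -> 'M[F]_m).
Local Notation L := (gsylv K A N B M).

Lemma gsylvD X Y : L (X + Y) = L X + L Y.
Proof.
rewrite /gsylv mulmxDr mulmxDl [in RHS]addrACA; congr (_ + _); first by rewrite addrACA.
rewrite -big_split; apply: eq_bigr => i _.
rewrite -big_split; apply: eq_bigr => j _ /=.
by rewrite mulmxDr mulmxDl scalerDr.
Qed.

Lemma gsylvZ a X : L (a *: X) = a *: L X.
Proof.
rewrite /gsylv !scalerDr -scalemxAr -scalemxAl; congr (_ + _).
rewrite scaler_sumr; apply: eq_bigr => i _.
rewrite scaler_sumr; apply: eq_bigr => j _.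
by rewrite -scalemxAr -scalemxAl !scalerA mulrC.
Qed.

Lemma gsylvB X Y : L (X - Y) = L X - L Y.
Proof. by rewrite gsylvD -[- Y]scaleN1r gsylvZ scaleN1r. Qed.

Lemma trmx_gsylv X : K^T = K -> (L X)^T = gsylv K B M A N X^T.
Proof.
move=> sK; rewrite /gsylv !linearD /= !trmx_mul trmxK [X in X + _]addrC.
congr (_ + _).
rewrite linear_sum exchange_big; apply: eq_bigr => i _ /=.
rewrite linear_sum /=; apply: eq_bigr => j _.
by rewrite linearZ /= !trmx_mul trmxK mulmxA -[in LHS]sK mxE.
Qed.
End GSylv.

(** Only the action on the particular matrix X is constrained: this is what lets
    both changes of basis and Petrov-Galerkin projections be pushed through the
    operator.  The same holds for [gsylv_mulr]. *)
Lemma gsylv_mull (F : comNzRingType) k n n' m (K : 'M[F]_k)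
    (A : 'M[F]_n) N (A' : 'M[F]_n') N' (B : 'M[F]_m) M X T :
  T *m A *m X = A' *m (T *m X) ->
  (forall i, T *m N i *m X = N' i *m (T *m X)) ->
  T *m gsylv K A N B M X = gsylv K A' N' B M (T *m X).
Proof.
move=> EA EN; rewrite /gsylv !mulmxDr !mulmxA EA !mulmxA; congr (_ + _).
rewrite mulmx_sumr; apply: eq_bigr => i _.
rewrite mulmx_sumr; apply: eq_bigr => j _.
by rewrite -scalemxAr !mulmxA EN !mulmxA.
Qed.

Lemma gsylv_mulr (F : comNzRingType) k n m m' (K : 'M[F]_k)
    (A : 'M[F]_n) N (B : 'M[F]_m) M (B' : 'M[F]_m') M' X T :
  X *m B^T *m T = X *m T *m B'^T ->
  (forall j, X *m (M j)^T *m T = X *m T *m (M' j)^T) ->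
  gsylv K A N B M X *m T = gsylv K A N B' M' (X *m T).
Proof.
move=> EB EM; rewrite /gsylv !mulmxDl EB !mulmxA; congr (_ + _).
rewrite mulmx_suml; apply: eq_bigr => i _.
rewrite mulmx_suml; apply: eq_bigr => j _.
by rewrite -scalemxAl -!mulmxA [X in N i *m X]mulmxA EM !mulmxA.
Qed.

Lemma gsylv_unique (F : comNzRingType) k n m (K : 'M[F]_k)
    (A : 'M[F]_n) N (B : 'M[F]_m) M X Y :
  gsylv_injective K A N B M ->
  gsylv K A N B M X = gsylv K A N B M Y -> X = Y.
Proof.
move=> inj E; apply/eqP; rewrite -subr_eq0; apply/eqP/inj.
by rewrite gsylvB E subrr.
Qed.

Lemma eq_gsylv (F : comNzRingType) k n m (K : 'M[F]_k)
    (A : 'M[F]_n) N N' (B : 'M[F]_m) M M' :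
  N =1 N' -> M =1 M' -> gsylv K A N B M =1 gsylv K A N' B M'.
Proof.
move=> EN EM X; rewrite /gsylv; congr (_ + _).
by apply: eq_bigr => i _; apply: eq_bigr => j _; rewrite EN EM.
Qed.

Lemma sum_block_mx (F : comNzRingType) (I : Type) (s : seq I) n1 n2 m1 m2
    (a : I -> 'M[F]_(n1, m1)) (b : I -> 'M_(n1, m2))
    (c : I -> 'M_(n2, m1)) (d : I -> 'M_(n2, m2)) :
  \sum_(i <- s) block_mx (a i) (b i) (c i) (d i) =
  block_mx (\sum_(i <- s) a i) (\sum_(i <- s) b i)
           (\sum_(i <- s) c i) (\sum_(i <- s) d i).
Proof.
elim: s => [|i s IH]; first by rewrite !big_nil -block_mx0.
by rewrite !big_cons IH add_block_mx.
Qed.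

Definition dsum_mx {F : comNzRingType} {n m : nat} (A : 'M[F]_n) (B : 'M[F]_m) :
    'M[F]_(n + m) :=
  block_mx A 0 0 B.

(** The operator of the direct sum of two systems acts blockwise; this is what
    links the mixed operator to the operators of the two systems. *)
Lemma gsylv_dsum (F : comNzRingType) k n m (K : 'M[F]_k)
    (A : 'M[F]_n) N (B : 'M[F]_m) M X11 X12 X21 X22 :
  let D := dsum_mx A B in let O i := dsum_mx (N i) (M i) in
  gsylv K D O D O (block_mx X11 X12 X21 X22) =
  block_mx (gsylv K A N A N X11) (gsylv K A N B M X12)
           (gsylv K B M A N X21) (gsylv K B M B M X22).
Proof.
rewrite /gsylv /dsum_mx /= tr_block_mx !trmx0 !mulmx_block.
rewrite !mul0mx !mulmx0 !addr0 !add0r add_block_mx.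
rewrite -[RHS]add_block_mx; congr (_ + _).
rewrite -sum_block_mx; apply: eq_bigr => i _.
rewrite -sum_block_mx; apply: eq_bigr => j _.
rewrite tr_block_mx !trmx0 !mulmx_block !mul0mx !mulmx0 !addr0 !add0r.
by rewrite scale_block_mx.
Qed.

(** * Vectorisation *)

(** The row-vector indexing of the Kronecker product [*t], which differs from
    the one of [mxvec]. *)
Definition unvec {F : comNzRingType} {n m : nat} (u : 'rV[F]_(n * m)) :
    'M[F]_(n, m) :=
  \matrix_(i, j) u 0 (mxtens_index (i, j)).

Definition vec {F : comNzRingType} {n m : nat} (X : 'M[F]_(n, m)) :
    'rV[F]_(n * m) :=
  \row_k X (mxtens_unindex k).1 (mxtens_unindex k).2.

Section Vec.
Variable F : comNzRingType.

Lemma vecK n m : cancel (@vec F n m) unvec.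
Proof. by move=> X; apply/matrixP => i j; rewrite !mxE mxtens_indexK. Qed.

Lemma unvecK n m : cancel (@unvec F n m) vec.
Proof.
move=> u; apply/matrixP => i k; rewrite (ord1 i) !mxE.
by rewrite -surjective_pairing mxtens_unindexK.
Qed.

Lemma unvecD n m (u v : 'rV[F]_(n * m)) : unvec (u + v) = unvec u + unvec v.
Proof. by apply/matrixP => i j; rewrite !mxE. Qed.

Lemma unvecZ n m a (u : 'rV[F]_(n * m)) : unvec (a *: u) = a *: unvec u.
Proof. by apply/matrixP => i j; rewrite !mxE. Qed.

Lemma unvec0 n m : unvec (0 : 'rV[F]_(n * m)) = 0.
Proof. by apply/matrixP => i j; rewrite !mxE. Qed.

Lemma unvec_tens n m n' m' (u : 'rV[F]_(n * m))
    (A : 'M_(n, n')) (B : 'M_(m, m')) :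
  unvec (u *m (A *t B)) = A^T *m unvec u *m B.
Proof.
apply/matrixP => i j; rewrite !mxE (reindex (@mxtens_index n m)) /=; last first.
  exists (@mxtens_unindex n m) => x _; first exact: mxtens_indexK.
  exact: mxtens_unindexK.
transitivity (\sum_a \sum_b u 0 (mxtens_index (a, b)) * (A a i * B b j)).
  by rewrite pair_bigA; apply: eq_bigr => -[a b] _; rewrite tensmxE.
rewrite exchange_big; apply: eq_bigr => b _ /=.
rewrite mxE mulr_suml; apply: eq_bigr => a _.
by rewrite !mxE mulrCA mulrA.
Qed.
End Vec.

(** * Consequences of stability *)

Section Stability.
Variables (R : realType) (k : nat) (K : 'M[R]_k).

(** No nonnegative real number is an eigenvalue of the Kronecker matrix: the
    consequence of stability that makes a homotopy to the identity possible.
    Stated by invertibility, it is invariant under transposition. *)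
Definition real_stable n (A : 'M[R]_n) (N : 'I_k -> 'M[R]_n) : Prop :=
  forall x : R, 0 <= x ->
  lyapunov_kron K (@System R 0 k 0 n A 0 0 N) - x%:M \in unitmx.

Lemma ms_stable_real m1 p n (s : system R m1 k p n) :
  ms_stable K s -> real_stable (sysA s) (sysN s).
Proof.
move=> st x x0; have := st x%:C%C; rewrite /cmx eigenvalue_map.
rewrite -row_free_unit -kermx_eq0 => H; apply/negPn/negP => ker.
have /H /= : eigenvalue (lyapunov_kron K s) x by rewrite /eigenvalue /eigenspace.
by rewrite ltNge x0.
Qed.

Lemma real_stable_tr n (A : 'M[R]_n) N :
  real_stable A N -> real_stable A^T (trN N).
Proof.
move=> st x x0; rewrite -unitmx_tr linearB /= tr_scalar_mx.
suff -> : (lyapunov_kron K (@System R 0 k 0 n A^T 0 0 (trN N)))^T =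
          lyapunov_kron K (@System R 0 k 0 n A 0 0 N) by exact: st.
rewrite /lyapunov_kron !linearD /= !trmx_tens !trmx1 trmxK; congr (_ + _).
rewrite linear_sum; apply: eq_bigr => i _ /=.
rewrite linear_sum; apply: eq_bigr => j _ /=.
by rewrite linearZ /= trmx_tens !trmxK.
Qed.

(** Row vectors multiplied on the right by the Kronecker matrix of a system give
    the operator of the transposed system. *)
Lemma unvec_lyapunov n (A : 'M[R]_n) N u :
  unvec (u *m lyapunov_kron K (@System R 0 k 0 n A 0 0 N)) =
  gsylv K A^T (trN N) A^T (trN N) (unvec u).
Proof.
rewrite /lyapunov_kron /gsylv !mulmxDr !unvecD !unvec_tens /=.
rewrite trmx1 mul1mx mulmx1 trmxK.
rewrite [X in X + _]addrC; congr (_ + _).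
rewrite mulmx_sumr (big_morph _ (@unvecD _ _ _) (@unvec0 _ _ _)).
apply: eq_bigr => i _.
rewrite mulmx_sumr (big_morph _ (@unvecD _ _ _) (@unvec0 _ _ _)).
apply: eq_bigr => j _.
by rewrite -scalemxAr unvecZ unvec_tens trmxK.
Qed.

Hypothesis pK : psd K.

(** The drift terms A X + X A^T vanish on the kernel of X, and the noise term is a
    Schur pairing of K with X. *)
Lemma gsylv_ker_ge0 n (A : 'M[R]_n) N X v : psd X -> X *m v = 0 ->
  0 <= bil (gsylv K A N A N X) v v.
Proof.
move=> pX Xv; have vX : v^T *m X = 0.
  by rewrite -(trmxK X) -trmx_mul pX.1 Xv trmx0.
rewrite /gsylv !bilDm -[A *m X]mulmx1 bil_mul mul1mx.
rewrite -[X *m A^T]mul1mx mulmxA bil_mul trmx1 mul1mx.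
have -> : bil X (A^T *m v) v = 0 by rewrite /bil -mulmxA Xv mulmx0 mxE.
have -> : bil X v (A^T *m v) = 0 by rewrite /bil vX mul0mx mxE.
rewrite !add0r bil_summ.
under eq_bigr do rewrite bil_summ.
under eq_bigr do under eq_bigr do rewrite bilZm bil_mul.
exact: psd_sum_ge0.
Qed.

(** The operators (1 - t) I - t L, 0 <= t <= 1, are all invertible by stability.
    Solving ((1 - t) I - t L)(X_t) = d(t) I, where d(t) > 0 is the determinant,
    gives by Cramer's rule a polynomial path from the identity to the wanted
    matrix, and a kernel vector v of a positive semidefinite X_t would satisfy
    d(t) |v|^2 = - t v^T L(X_t) v <= 0. *)
Lemma stable_lyapunov_tr n (A : 'M[R]_n) N : real_stable A N ->
  exists P d,
    [/\ psd P, 0 < d & gsylv K A^T (trN N) A^T (trN N) P = - d%:M].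
Proof.
move=> st.
pose L := gsylv K A^T (trN N) A^T (trN N).
pose H := lyapunov_kron K (@System R 0 k 0 n A 0 0 N).
pose U : 'M[{poly R}]_(n * n) := (1 - 'X)%:M - 'X *: map_mx polyC H.
have Ut t : mxeval U t = (1 - t)%:M - t *: H.
  apply/matrixP => i j; rewrite !mxE /horner_eval !hornerE.
  by case: eqP => _; rewrite ?mulr1n ?mulr0n !hornerE.
have uU t : 0 <= t <= 1 -> mxeval U t \in unitmx.
  move=> /andP[]; rewrite le_eqVlt => /predU1P[<-|t0] t1.
    by rewrite Ut subr0 scale0r subr0 unitmx1.
  have -> : mxeval U t = (- t) *: (H - ((1 - t) / t)%:M).
    rewrite Ut scalerBr !scaleNr opprK scale_scalar_mx addrC; congr (_ + _%:M).
    by rewrite mulrC divfK ?gt_eqF.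
  rewrite unitmxZ ?unitfE ?oppr_eq0 ?gt_eqF // st //.
  by rewrite divr_ge0 ?subr_ge0 // ltW.
pose d := \det U.
have dE t : d.[t] = \det (mxeval U t) by rewrite /mxeval det_map_mx.
have d0 : d.[0] = 1 by rewrite dE Ut subr0 scale0r subr0 det1.
have dn0 t : 0 <= t <= 1 -> d.[t] != 0 by move=> /uU; rewrite dE unitmxE unitfE.
(* d has no root in [0, 1] and d(0) = 1 *)
have dpos t : 0 <= t <= 1 -> 0 < d.[t].
  move=> t01; rewrite lt_neqAle eq_sym dn0 //= leNgt; apply/negP => dt.
  have /andP[t0 t1] := t01.
  have dd : d.[0] * d.[t] <= 0 by rewrite d0 mul1r ltW.
  have [x /itvP xt /rootP /eqP] := polyrcf.poly_ivt t0 dd.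
  by rewrite (negPf (dn0 x _)) // xt (le_trans _ t1) ?xt.
pose w : 'rV[R]_(n * n) := vec (1%:M : 'M[R]_n).
pose F : 'M[{poly R}]_n := unvec (map_mx polyC w *m \adj U).
have FE t : mxeval F t = unvec (w *m \adj (mxeval U t)).
  rewrite /mxeval -map_mx_adj.
  have -> : w = map_mx (horner_eval t) (map_mx polyC w).
    by apply/matrixP => i j; rewrite !mxE /horner_eval hornerC.
  by rewrite -map_mxM; apply/matrixP => i j; rewrite !mxE.
have LF t : (1 - t) *: mxeval F t - t *: L (mxeval F t) = d.[t]%:M.
  rewrite FE /L -unvec_lyapunov -/H; set u := w *m _.
  have -> : (1 - t) *: unvec u - t *: unvec (u *m H) = unvec (u *m mxeval U t).
    rewrite Ut mulmxBr mul_mx_scalar -scalemxAr -[- (t *: (_ *m _))]scaleN1r.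
    by rewrite unvecD !unvecZ scaleN1r.
  rewrite /u -mulmxA mul_adj_mx mul_mx_scalar -dE unvecZ vecK.
  by rewrite scale_scalar_mx mulr1.
(* X_t is symmetric because its transpose solves the same equation *)
have FT t : 0 <= t <= 1 -> (mxeval F t)^T = mxeval F t.
  move=> t01.
  have inj X : (1 - t) *: X - t *: L X = 0 -> X = 0.
    move=> X0; rewrite -(vecK X); suff -> : vec X = 0 by rewrite unvec0.
    rewrite -[vec X](mulmxK (uU t t01)).
    suff -> : vec X *m mxeval U t = 0 by rewrite mul0mx.
    apply: (can_inj (@unvecK _ _ _)); rewrite unvec0.
    rewrite Ut mulmxBr mul_mx_scalar -scalemxAr -scaleN1r unvecD !unvecZ.
    by rewrite unvec_lyapunov vecK scaleN1r.
  apply/eqP; rewrite -subr_eq0; apply/eqP/inj.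
  have := congr1 trmx (LF t); rewrite tr_scalar_mx linearB /= !linearZ /=.
  rewrite (trmx_gsylv _ _ _ _ _ pK.1) -/L -[RHS](LF t) scalerN.
  rewrite /L gsylvB -/L; set X := mxeval F t.
  move: X (X^T) (L X) (L X^T) => X4 X3 X2 X1 E1.
  transitivity (((1 - t) *: X3 - t *: X1) - ((1 - t) *: X4 - t *: X2));
    last by rewrite E1 subrr.
  by apply/matrixP => i j; rewrite !mxE; ring.
exists (mxeval F 1), d.[1]; split; last first.
- by have := LF 1; rewrite subrr scale0r sub0r scale1r => <-; rewrite opprK.
- by apply: dpos; rewrite lexx ler01.
apply: psd_path => // [|t v t01 pF Fv].
  have := LF 0; rewrite subr0 scale0r subr0 scale1r d0 => ->.
  by split=> [|v]; rewrite ?tr_scalar_mx // bil1_ge0.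
apply: bil1_eq0; apply/eqP; rewrite eq_le bil1_ge0 andbT.
have /(congr1 (fun M => bil M v v)) := LF t.
have dt := dpos t t01.
rewrite bilDm bilZm -scaleNr bilZm -[d.[t]%:M]scalemx1 bilZm.
have -> : bil (mxeval F t) v v = 0 by rewrite /bil -mulmxA Fv mulmx0 mxE.
have := gsylv_ker_ge0 A^T (trN N) pF Fv; rewrite -/L => L0 E.
by rewrite -(pmulr_rle0 _ dt) -E mulr0 add0r mulNr oppr_le0 mulr_ge0;
  case/andP: t01.
Qed.

Lemma stable_lyapunov n (A : 'M[R]_n) N : real_stable A N ->
  exists P d, [/\ psd P, 0 < d & gsylv K A N A N P = - d%:M].
Proof.
move=> /real_stable_tr/stable_lyapunov_tr [P [d [pP d0 E]]].
exists P, d; split=> //.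
rewrite -E /gsylv trmxK; congr (_ + _).
by apply: eq_bigr => i _; apply: eq_bigr => j _; rewrite /trN !trmxK.
Qed.

(** Along t |-> P - t c Z the image under the operator is constantly that of P,
    so P - c Z is positive semidefinite for every real c, which leaves only
    v^T Z v = 0 for all v. *)
Lemma lyapunov_sym_inj n (A : 'M[R]_n) N P Z : psd P ->
  (forall v, bil (gsylv K A N A N P) v v < 0 \/ v = 0) ->
  Z^T = Z -> gsylv K A N A N Z = 0 -> Z = 0.
Proof.
move=> pP LP sZ LZ.
have key c : psd (P - c *: Z).
  pose F : 'M[{poly R}]_n := map_mx polyC P - (c *: 'X) *: map_mx polyC Z.
  have FE t : mxeval F t = P - (t * c) *: Z.
    by apply/matrixP => i j; rewrite !mxE /horner_eval !hornerE [c * t]mulrC.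
  rewrite -[c]mul1r -FE; apply: psd_path => [t _||t v _ pF Fv].
  - by rewrite FE linearB /= linearZ /= sZ pP.1.
  - by rewrite FE mul0r scale0r subr0.
  have := gsylv_ker_ge0 A N pF Fv; rewrite FE gsylvB gsylvZ LZ scaler0 subr0.
  by case: (LP v) => // /lt_geF ->.
have Z0 v : bil Z v v = 0.
  apply/eqP; apply: contraT => b0.
  have := (key ((bil P v v + 1) / bil Z v v)).2 v.
  by rewrite bilDm -scaleNr bilZm mulNr divfK //; lra.
have pZ : psd Z by split=> // v; rewrite Z0.
apply/matrixP => i j; have := psd_ker pZ (Z0 (delta_mx j 0)).
by rewrite -colE => /matrixP/(_ i 0); rewrite !mxE.
Qed.

(** The mixed operator is the off-diagonal block of the operator of the direct sum
    system, for which diag(P, Q) serves as the matrix with negative definite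
    image. *)
Lemma gsylv_inj n m (A : 'M[R]_n) N (B : 'M[R]_m) M :
  real_stable A N -> real_stable B M -> gsylv_injective K A N B M.
Proof.
move=> /stable_lyapunov [P [a [pP a0 LP]]] /stable_lyapunov [Q [b [pQ b0 LQ]]] X LX.
have L0 k1 k2 (A1 : 'M[R]_k1) N1 (A2 : 'M[R]_k2) N2 : gsylv K A1 N1 A2 N2 0 = 0.
  by rewrite -[0](scale0r (0 : 'M[R]_(k1, k2))) gsylvZ !scale0r.
have bilD k1 k2 (S1 : 'M[R]_k1) (S2 : 'M[R]_k2) u v :
    bil (dsum_mx S1 S2) (col_mx u v) (col_mx u v) = bil S1 u u + bil S2 v v.
  rewrite /bil /dsum_mx tr_col_mx mul_row_block mul_row_col.
  by rewrite !mulmx0 addr0 add0r mxE.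
have := @lyapunov_sym_inj _ (dsum_mx A B) (fun i => dsum_mx (N i) (M i))
  (dsum_mx P Q) (block_mx 0 X X^T 0).
rewrite {1 2}/dsum_mx !gsylv_dsum LP LQ LX !L0.
rewrite -(trmx_gsylv _ _ _ _ X pK.1) LX trmx0 tr_block_mx trmxK !trmx0.
rewrite -/(dsum_mx P Q) -/(dsum_mx _ _) => H.
suff : block_mx 0 X X^T 0 = 0 :> 'M[R]_(n + m).
  move=> /(congr1 ursubmx); rewrite block_mxKur => ->.
  by apply/matrixP => i j; rewrite !mxE.
apply: H => //; last by rewrite block_mx0.
  split; first by rewrite /dsum_mx tr_block_mx !trmx0 pP.1 pQ.1.
  by move=> v; rewrite -[v]vsubmxK bilD addr_ge0 ?pP.2 ?pQ.2.
move=> v; rewrite -[v]vsubmxK bilD.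
move: (usubmx v) (dsubmx v) => x y.
rewrite -[a%:M]scalemx1 -[b%:M]scalemx1 -!scaleNr !bilZm.
have := bil1_ge0 x; have := bil1_ge0 y.
rewrite le_eqVlt => /predU1P [y0|y0]; rewrite le_eqVlt => /predU1P [x0|x0].
- by right; rewrite (bil1_eq0 (esym x0)) (bil1_eq0 (esym y0)) col_mx0.
all: left; nra.
Qed.

End Stability.

(** * Interpolation at a fixed point *)

(** With U = T^-1, the spectral coordinates S of a model are coordinates S U of the
    model transformed by T. *)
Lemma conj_change (F : comUnitRingType) r (S T U X : 'M[F]_r) :
  S \in unitmx -> U *m T = 1%:M ->
  S *m X *m invmx S *m (S *m U) = S *m U *m (T *m X *m U).
Proof.
by move=> uS UT; rewrite [LHS]mulmxA mulmxKV // -!mulmxA (mulmxA U) UT mul1mx.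
Qed.

Section Interpolation.
Variables (F : fieldType) (n r m1 m2 p : nat) (K : 'M[F]_m2) (Wt : 'M[F]_m1).
Variables (A : 'M[F]_n) (B : 'M[F]_(n, m1))
  (C : 'M[F]_(p, n)) (N : 'I_m2 -> 'M[F]_n).
Variables (Ah : 'M[F]_r) (Bh : 'M[F]_(r, m1))
  (Ch : 'M[F]_(p, r)) (Nh : 'I_m2 -> 'M[F]_r).
Hypothesis sK : K^T = K.
Hypothesis inj2 : gsylv_injective K A N Ah Nh.
Hypothesis injh : gsylv_injective K Ah Nh Ah Nh.
Hypothesis injt2 : gsylv_injective K A^T (trN N) Ah^T (trN Nh).
Hypothesis injth : gsylv_injective K Ah^T (trN Nh) Ah^T (trN Nh).
Variables (Ph : 'M[F]_r) (P2 : 'M[F]_(n, r)) (Qh : 'M[F]_r) (Q2 : 'M[F]_(r, n)).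
Hypothesis PhE : gsylv K Ah Nh Ah Nh Ph = - ((Bh *m Wt) *m (Bh *m Wt)^T).
Hypothesis P2E : gsylv K A N Ah Nh P2 = - ((B *m Wt) *m (Bh *m Wt)^T).
Hypothesis QhE : gsylv K Ah^T (trN Nh) Ah^T (trN Nh) Qh = - (Ch^T *m Ch).
Hypothesis Q2E : gsylv K Ah^T (trN Nh) A^T (trN N) Q2 = - (Ch^T *m C).

(** The relations D S = S Ah and Nt_i S = S Nh_i let S be moved through the
    Sylvester operators by [gsylv_mulr]. *)
Section SpectralCoordinates.
Variables (S D : 'M[F]_r) (Bt : 'M[F]_(r, m1))
  (Ct : 'M[F]_(p, r)) (Nt : 'I_m2 -> 'M[F]_r).
Hypothesis uS : S \in unitmx.
Hypothesis DS : D *m S = S *m Ah.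
Hypothesis NtS : forall i, Nt i *m S = S *m Nh i.
Hypothesis BtE : Bt = S *m Bh.
Hypothesis CtS : Ct *m S = Ch.

Lemma spectral_V V :
  gsylv K A N D Nt V = - ((B *m Wt) *m (Bt *m Wt)^T) -> V = P2 *m S^T.
Proof.
move=> VE; set T := (invmx S)^T.
have TS : T *m S^T = 1%:M by rewrite /T -trmx_mul mulmxV // trmx1.
have swap X Y : X *m S = S *m Y -> X^T *m T = T *m Y^T.
  by move=> XY; rewrite /T -!trmx_mul -[X](mulmxK uS) XY -!mulmxA mulKmx.
suff <- : V *m T = P2 by rewrite -mulmxA TS mulmx1.
apply: (gsylv_unique inj2); rewrite P2E -(@gsylv_mulr _ _ _ _ _ K A N D Nt).
- rewrite VE mulNmx BtE -[S *m Bh *m Wt]mulmxA [(S *m _)^T]trmx_mul -!mulmxA.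
  by rewrite -[S^T *m T]trmx_mul mulVmx // trmx1 mulmx1.
- by rewrite -!mulmxA (swap _ _ DS).
- by move=> j; rewrite -!mulmxA (swap _ _ (NtS j)).
Qed.

Lemma spectral_W W :
  gsylv K A^T (trN N) D^T (trN Nt) W = - (C^T *m Ct) -> W *m S = Q2^T.
Proof.
move=> WE; apply: (gsylv_unique injt2).
rewrite -(trmx_gsylv _ _ _ _ Q2 sK) Q2E -(@gsylv_mulr _ _ _ _ _ K _ _ D^T (trN Nt)).
- by rewrite WE mulNmx -mulmxA CtS linearN /= trmx_mul trmxK.
- by rewrite !trmxK -!mulmxA DS.
- by move=> j; rewrite /trN !trmxK -!mulmxA NtS.
Qed.
End SpectralCoordinates.

Section Projection.
Variables (Vo : 'M[F]_(n, r)) (T : 'M[F]_(r, n)) (G H : 'M[F]_r).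
Hypothesis TV : T *m Vo = 1%:M.
Hypothesis VoE : Vo = P2 *m G.
Hypothesis Q2T : Q2 = H *m T.
Hypothesis AhE : Ah = T *m A *m Vo.
Hypothesis NhE : forall i, Nh i = T *m N i *m Vo.
Hypothesis BhE : Bh = T *m B.
Hypothesis ChE : Ch = C *m Vo.

(** Vo T is a projection that fixes P2 on the left and Q2 on the right; it
    therefore carries P2 to Ph = T P2 and Q2 to Qh = Q2 Vo, and inserting it
    between the factors of the right-hand sides produces the reduced matrices. *)
Lemma projection_interpolates :
  [/\ Ch *m Ph = C *m P2, Qh *m Ph = Q2 *m P2,
      forall j, Qh *m Nh j *m Ph = Q2 *m N j *m P2 & Qh *m Bh = Q2 *m B].
Proof.
have GT : G *m (T *m P2) = 1%:M by apply: mulmx1C; rewrite -mulmxA -VoE.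
have P2V : P2 = Vo *m (T *m P2) by rewrite VoE -mulmxA GT mulmx1.
have Q2V : Q2 = Q2 *m Vo *m T by rewrite Q2T -!mulmxA (mulmxA T) TV mul1mx.
have PhT : T *m P2 = Ph.
  apply: (gsylv_unique injh).
  rewrite PhE -(@gsylv_mull _ _ _ _ _ K A N) => [||i].
  - by rewrite P2E mulmxN BhE !mulmxA.
  - by rewrite AhE -!mulmxA -P2V.
  - by rewrite NhE -!mulmxA -P2V.
have QhV : Q2 *m Vo = Qh.
  apply: (gsylv_unique injth).
  rewrite QhE -(@gsylv_mulr _ _ _ _ _ K _ _ A^T (trN N)) => [||i].
  - by rewrite Q2E mulNmx ChE !mulmxA.
  - by rewrite !trmxK AhE !mulmxA -Q2V.
  - by rewrite /trN !trmxK NhE !mulmxA -Q2V.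
rewrite -PhT -QhV; split => [||j|].
- by rewrite ChE -mulmxA -P2V.
- by rewrite -mulmxA -P2V.
- by rewrite NhE !mulmxA -Q2V -!mulmxA -P2V.
- by rewrite BhE mulmxA -Q2V.
Qed.
End Projection.
End Interpolation.

(** * Passage to complex scalars *)

Section Complexification.
Variable R : realType.

Lemma cmxN n m (X : 'M[R]_(n, m)) : cmx (- X) = - cmx X.
Proof. by rewrite /cmx map_mxN. Qed.

Lemma cmxM n m l (X : 'M[R]_(n, m)) (Y : 'M[R]_(m, l)) :
  cmx (X *m Y) = cmx X *m cmx Y.
Proof. by rewrite /cmx map_mxM. Qed.

Lemma cmxT n m (X : 'M[R]_(n, m)) : cmx X^T = (cmx X)^T.
Proof. by rewrite /cmx map_trmx. Qed.

Lemma cmx_gsylv k n m (K : 'M[R]_k) (A : 'M[R]_n) N (B : 'M[R]_m) M X :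
  cmx (gsylv K A N B M X) =
  gsylv (cmx K) (cmx A) (fun i => cmx (N i)) (cmx B) (fun i => cmx (M i))
    (cmx X).
Proof.
rewrite /cmx /gsylv !map_mxD !map_mxM map_trmx; congr (_ + _).
rewrite map_mx_sum; apply: eq_bigr => i _.
rewrite map_mx_sum; apply: eq_bigr => j _.
by rewrite map_mxZ !map_mxM map_trmx mxE.
Qed.

Lemma cmx_inj n m (X Y : 'M[R]_(n, m)) : cmx X = cmx Y -> X = Y.
Proof. exact: map_mx_inj. Qed.

Lemma cmx_Re_Im n m (X : 'M[R[i]]_(n, m)) :
  X = cmx (map_mx (@complex.Re R) X) + 'i%C *: cmx (map_mx (@complex.Im R) X).
Proof. by apply/matrixP => i j; rewrite !mxE [LHS]complexE. Qed.

(** The iteration works over the complex numbers; the operators are real, so their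
    kernels are spanned by real and imaginary parts. *)
Lemma gsylv_injective_cmx k n m (K : 'M[R]_k) (A : 'M[R]_n) N (B : 'M[R]_m) M :
  gsylv_injective K A N B M ->
  gsylv_injective (cmx K) (cmx A) (fun i => cmx (N i))
    (cmx B) (fun i => cmx (M i)).
Proof.
move=> inj X; rewrite (cmx_Re_Im X) gsylvD gsylvZ -!cmx_gsylv.
set X1 := map_mx _ X; set X2 := map_mx _ X => LX.
have [L1 L2] : gsylv K A N B M X1 = 0 /\ gsylv K A N B M X2 = 0.
  split; apply/matrixP => i j; move/matrixP/(_ i j): LX; rewrite !mxE => /eqP;
  rewrite eq_complex /= => /andP[/eqP + /eqP];
  by rewrite !(mul0r, mul1r, mulr0, subr0, add0r, addr0).
by rewrite (inj _ L1) (inj _ L2) /cmx !map_mx0 scaler0 addr0.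
Qed.

Lemma cmx_gsylv_tr k n m (K : 'M[R]_k) (A : 'M[R]_n) N (B : 'M[R]_m) M
    (X : 'M[R[i]]_(n, m)) :
  gsylv (cmx K) (cmx A^T) (fun i => cmx (trN N i))
    (cmx B^T) (fun i => cmx (trN M i)) X =
  gsylv (cmx K) (cmx A)^T (trN (fun i => cmx (N i)))
    (cmx B)^T (trN (fun i => cmx (M i))) X.
Proof.
by rewrite /cmx !map_trmx; apply: eq_gsylv => i; rewrite /trN map_trmx.
Qed.
End Complexification.

Theorem theorem2p5 (R : realType) (n r m1 m2 p : nat)
  (A : 'M[R]_n) (B1 : 'M[R]_(n, m1)) (C : 'M[R]_(p, n)) (N : 'I_m2 -> 'M[R]_n)
  (K : 'M[R]_m2) (Wt : 'M[R]_m1)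
  (Ah : 'M[R]_r) (B1h : 'M[R]_(r, m1)) (Ch : 'M[R]_(p, r)) (Nh : 'I_m2 -> 'M[R]_r)
  (Ph : 'M[R]_r) (P2 : 'M[R]_(n, r)) (Qh : 'M[R]_r) (Q2 : 'M[R]_(r, n)) :
  covariance_mx K ->
  Wt \in unitmx ->
  ms_stable K (System A B1 C N) ->
  ms_stable K (System Ah B1h Ch Nh) ->
  diagonalizable (cmx Ah) ->
  birka_output K Wt (System A B1 C N) (System Ah B1h Ch Nh) ->
  Ah *m Ph + Ph *m Ah^T
    + \sum_(i < m2) \sum_(j < m2) K i j *: (Nh i *m Ph *m (Nh j)^T)
  = - ((B1h *m Wt) *m (B1h *m Wt)^T) ->
  A *m P2 + P2 *m Ah^T
    + \sum_(i < m2) \sum_(j < m2) K i j *: (N i *m P2 *m (Nh j)^T)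
  = - ((B1 *m Wt) *m (B1h *m Wt)^T) ->
  Ah^T *m Qh + Qh *m Ah
    + \sum_(i < m2) \sum_(j < m2) K i j *: ((Nh i)^T *m Qh *m Nh j)
  = - (Ch^T *m Ch) ->
  Ah^T *m Q2 + Q2 *m A
    + \sum_(i < m2) \sum_(j < m2) K i j *: ((Nh i)^T *m Q2 *m N j)
  = - (Ch^T *m C) ->
  [/\ Ch *m Ph = C *m P2,
      Qh *m Ph = Q2 *m P2,
      forall i : 'I_m2,
        Qh *m (\sum_(j < m2) K i j *: Nh j) *m Ph
        = Q2 *m (\sum_(j < m2) K i j *: N j) *m P2
    & Qh *m B1h *m Wt *m Wt^T = Q2 *m B1 *m Wt *m Wt^T].
Proof.
move=> covK _ stA stAh _ [k [x [step conv romE]]] PhE P2E QhE Q2E.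
have pK : psd K := covK.
have {stA} stA : real_stable K A N := ms_stable_real stA.
have {stAh} stAh : real_stable K Ah Nh := ms_stable_real stAh.
have stAT := real_stable_tr stA; have stAhT := real_stable_tr stAh.
have QE m (Mt : 'M[R]_m) (L : 'I_m2 -> 'M[R]_m) (Q : 'M[R]_(r, m)) :
    gsylv K Ah^T (trN Nh) Mt^T (trN L) Q =
    Ah^T *m Q + Q *m Mt + \sum_i \sum_j K i j *: ((Nh i)^T *m Q *m L j).
  rewrite /gsylv trmxK; congr (_ + _).
  by apply: eq_bigr => i _; apply: eq_bigr => j _; rewrite /trN trmxK.
rewrite -QE in QhE; rewrite -QE in Q2E.
have cK : (cmx K)^T = cmx K by rewrite -cmxT pK.1.
have inj2 := gsylv_injective_cmx (gsylv_inj pK stA stAh).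
have injh := gsylv_injective_cmx (gsylv_inj pK stAh stAh).
have injt2 := gsylv_injective_cmx (gsylv_inj pK stAT stAhT).
have injth := gsylv_injective_cmx (gsylv_inj pK stAhT stAhT).
have {}injt2 : gsylv_injective (cmx K) (cmx A)^T (trN (fun i => cmx (N i)))
    (cmx Ah)^T (trN (fun i => cmx (Nh i))).
  by move=> X; rewrite -cmx_gsylv_tr; exact: injt2.
have {}injth : gsylv_injective (cmx K) (cmx Ah)^T (trN (fun i => cmx (Nh i)))
    (cmx Ah)^T (trN (fun i => cmx (Nh i))).
  by move=> X; rewrite -cmx_gsylv_tr; exact: injth.
move: PhE P2E QhE Q2E => /(congr1 (@cmx R _ _)) + /(congr1 (@cmx R _ _)) +
  /(congr1 (@cmx R _ _)) + /(congr1 (@cmx R _ _)).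
rewrite -/(gsylv K Ah Nh Ah Nh Ph) -/(gsylv K A N Ah Nh P2) !cmx_gsylv.
rewrite !cmxN !cmxM !cmx_gsylv_tr !cmxT !cmxM => PhE P2E QhE Q2E.
have := step k (leqnn k); rewrite -romE => -[S [V [W [Vo [Wo]]]]] /=.
move=> [[uS dD] [VE [WE [[[_ /andP[oV _]] [_ /andP[oW _]]] [uVW]]]]].
move=> [/= AhE BhE ChE NhE].
case: conv => T uT; rewrite -romE => -[/= TA TB TC TN].
(* spectral coordinates of the transformed, that is, of the final model *)
pose S' := S *m cmx (invmx T).
have cI : cmx (invmx T) *m cmx T = 1%:M by rewrite -cmxM mulVmx // /cmx map_mx1.
have uS' : S' \in unitmx by rewrite unitmx_mul uS /cmx map_unitmx unitmx_inv.
have sim X : S *m cmx X *m invmx S *m S' = S' *m cmx (T *m X *m invmx T).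
  by rewrite !cmxM; exact: conj_change.
set D := S *m _ *m _ in dD VE WE.
(* the step writes V D where the Sylvester operator has V D^T *)
have sD : D^T = D.
  apply/matrixP => i j; rewrite mxE; have [->//|ij] := eqVneq i j.
  by move/is_diag_mxP: dD => dD; rewrite !dD // eq_sym.
have DS : D *m S' = S' *m cmx Ah by rewrite sim TA.
have NtS i : S *m cmx (sysN (x k) i) *m invmx S *m S' = S' *m cmx (Nh i).
  by rewrite sim TN.
have BtE : S *m cmx (sysB (x k)) = S' *m cmx B1h.
  by rewrite TB cmxM /S' mulmxA -(mulmxA S) cI mulmx1.
have CtS : cmx (sysC (x k)) *m invmx S *m S' = cmx Ch.
  by rewrite TC cmxM /S' mulmxA mulmxKV.
have {}VE : V = cmx P2 *m S'^T.
  apply: (spectral_V inj2 P2E uS' DS NtS BtE).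
  rewrite -VE /gsylv sD [X in X + _]addrC.
  by congr (_ + _); apply: eq_bigr => i _; apply: eq_bigr => j _; rewrite mxE.
have {}WE : W *m S' = (cmx Q2)^T.
  apply: (spectral_W cK injt2 Q2E DS NtS CtS).
  rewrite -WE /gsylv trmxK [X in X + _]addrC; congr (_ + _).
  by apply: eq_bigr => i _; apply: eq_bigr => j _; rewrite mxE /trN trmxK.
have [G VoE] : exists G, Vo = cmx P2 *m G.
  have [X XE] := submxP oV; exists (S'^T *m X^T).
  by rewrite -[Vo]trmxK XE VE trmx_mul trmxK mulmxA.
have [H WoE] : exists H, Wo^T = H *m cmx Q2.
  have [X XE] := submxP oW; exists (X *m (invmx S')^T).
  by rewrite XE -mulmxA -[cmx Q2]trmxK -WE -trmx_mul mulmxK.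
have uH : H \in unitmx by move: uVW; rewrite WoE -mulmxA unitmx_mul => /andP[].
have [] := @projection_interpolates _ _ _ _ _ _ _ (cmx Wt)
  (cmx A) (cmx B1) (cmx C) (fun i => cmx (N i))
  (cmx Ah) (cmx B1h) (cmx Ch) (fun i => cmx (Nh i)) injh injth
  (cmx Ph) (cmx P2) (cmx Qh) (cmx Q2) PhE P2E QhE Q2E
  Vo (invmx (Wo^T *m Vo) *m Wo^T) G (invmx H *m (Wo^T *m Vo))
  _ VoE _ AhE NhE BhE ChE.
- by rewrite -mulmxA mulVmx.
- by rewrite -[RHS]mulmxA mulKVmx // WoE mulKmx.
rewrite -!cmxM => /cmx_inj Ea /cmx_inj Eb Ec /cmx_inj Ed.
split=> // [i|]; last by rewrite Ed.
rewrite !mulmx_sumr !mulmx_suml; apply: eq_bigr => j _.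
rewrite -!scalemxAr -!scalemxAl; congr (_ *: _).
by apply: cmx_inj; rewrite !cmxM; exact: Ec.
Qed.
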